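(* Let $n,d\in\omega$ be such that $n\geq 2$. Then the set $\mathrm{L}(n)\cup \mathrm{L}(n+1)\cup\dots\cup \mathrm{L}(n+d)$ is $(d+1)$-lineable, but not $(d+2)$-lineable.
   Context: $\ell_\infty$ is the real Banach space of bounded real sequences $x=(x(n))_{n\in\omega}$, where $\omega=\{0,1,2,\dots\}$. For $x\in\ell_\infty$, a real $\eta$ is an accumulation point of $x$ if $\{n\in\omega: |x(n)-\eta|<\varepsilon\}$ is infinite for all $\varepsilon>0$; $\mathrm{L}_x$ denotes the set of accumulation points of $x$. For a cardinal $\kappa$, $\mathrm{L}(\kappa)=\{x\in\ell_\infty: |\mathrm{L}_x|=\kappa\}$. A subset $M$ of a vector space $X$ is $\kappa$-lineable, for a cardinal $\kappa$, if $M\cup\{0\}$ contains a linear subspace of $X$ of dimension $\kappa$. *)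

(* Defs.v *)
From HB Require Import structures.
From mathcomp Require Import all_boot all_order all_algebra.
From mathcomp Require Import all_classical all_reals all_analysis.

Set Implicit Arguments.
Unset Strict Implicit.
Unset Printing Implicit Defensive.

Import Order.TTheory GRing.Theory Num.Theory.
Import numFieldNormedType.Exports.

Local Open Scope classical_set_scope.
Local Open Scope card_scope.
Local Open Scope ring_scope.

Section linfty.
Variable R : realType.

Definition bounded_seq : {pred nat -> R} :=
  mem [set x : nat -> R | exists M : R, forall n, `|x n| <= M].

Lemma bounded_seq_submod_closed : submod_closed bounded_seq.
Proof.
split.
  by rewrite inE; exists 0 => n; rewrite normr0.
move=> a x y; rewrite !inE => -[M xM] [N yN].
exists (`|a| * M + N) => n; apply: (le_trans (ler_normD _ _)).
by apply: lerD => //; rewrite normrM ler_wpM2l.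
Qed.

HB.instance Definition _ := GRing.isSubmodClosed.Build R (nat -> R)
  bounded_seq bounded_seq_submod_closed.

(* The norm of l_infty plays no role in lineability: only its structure of
   real vector space is declared. *)
Record linfty := Linfty {
  linfty_seq :> nat -> R ;
  linfty_seqP : linfty_seq \in bounded_seq }.

HB.instance Definition _ := [isSub for linfty_seq].
HB.instance Definition _ := [Choice of linfty by <:].
HB.instance Definition _ := [SubChoice_isSubLmodule of linfty by <:].

End linfty.

(* V has no finiteness assumption, so the library's finite-dimensional theory of
   bases does not apply. *)
Section dimension.
Context {R : realType} {V : lmodType R}.
Implicit Types (B W : set V) (s : seq V).

Definition lin_indep B := forall s (c : V -> R), uniq s -> [set` s] `<=` B ->
  \sum_(v <- s) c v *: v = 0 -> forall v, v \in s -> c v = 0.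

Definition lin_span B : set V :=
  [set w | exists s (c : V -> R),
     [set` s] `<=` B /\ w = \sum_(v <- s) c v *: v].

Definition linear_subspace W := submod_closed (mem W).

(* A cardinal is represented by any set K of that cardinality. *)
Definition has_dimension {T : Type} W (K : set T) :=
  exists B, [/\ lin_indep B, lin_span B = W & B #= K].

Definition lineable {T : Type} (K : set T) (M : set V) :=
  exists W, [/\ linear_subspace W, has_dimension W K & W `<=` M `|` [set 0]].

End dimension.

Section accumulation.
Context {R : realType}.

Definition acc_pt (x : linfty R) (eta : R) := forall eps : R, 0 < eps ->
  infinite_set [set n | `|x n - eta| < eps].

Definition acc_set (x : linfty R) : set R := [set eta | acc_pt x eta].

Definition Lcard {T : Type} (K : set T) : set (linfty R) :=
  [set x | acc_set x #= K].

End accumulation.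

(* Main.v *)
(* For x_a = sum_i a_i v_i, the accumulation points of x_a are the values
   a(p), where p runs over the limits of (v_1, ..., v_k) along the free
   ultrafilters on nat. If every v_i has finitely many accumulation points, then
   the p's form a finite set P of vectors of R^k.

   Upper bound: let k = d + 2. A generic functional is injective on P, so
   |P| <= n + d; a nonzero functional annihilating d + 1 differences p_i - p_0
   takes at most max (1, |P| - (d + 1)) <= n - 1 values on P.

   Lower bound: let N = n + d. The vectors of R^N with at most n - 1 distinct
   entries form a finite union of subspaces of dimension at most n - 1, so some
   subspace of dimension d + 1 = N - (n - 1) meets this union only in 0.
   Repeating its vectors N-periodically turns their entries into accumulation
   points. *)
Require Import Defs.
From mathcomp Require Import all_boot all_order all_algebra finmap zify.
From mathcomp Require Import all_classical all_reals all_analysis.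

Set Implicit Arguments.
Unset Strict Implicit.
Unset Printing Implicit Defensive.

Import Order.TTheory GRing.Theory Num.Theory.
Import numFieldNormedType.Exports.

Local Open Scope classical_set_scope.
Local Open Scope card_scope.
Local Open Scope ring_scope.

(** * Generic vectors, and the number of distinct entries in a row space *)

Section LinearAlgebra.
Variable F : numFieldType.

(* The witness lies on the moment curve [t |-> (1, t, ..., t^(N-1))], of which
   a hyperplane contains finitely many points. *)
Lemma avoid_hyperplanes N (I : eqType) (s : seq I) (c : I -> 'cV[F]_N) :
  (forall i, i \in s -> c i != 0) ->
  exists v : 'rV[F]_N, forall i, i \in s -> (v *m c i) 0 0 != 0.
Proof.
move=> c_neq0.
pose p i := \poly_(j < N) (if insub j is Some k then c i k 0 else 0).
have pE i (t : F) : ((\row_(j < N) t ^+ j) *m c i) 0 0 = (p i).[t].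
  rewrite mxE horner_poly; apply: eq_bigr => j _.
  by rewrite mxE valK mulrC.
have p_neq0 i : i \in s -> p i != 0.
  move=> /c_neq0; apply: contra_neq => p0; apply/matrixP => k j.
  have := coef0 F k; rewrite -p0 coef_poly ltn_ord valK => h.
  by rewrite (ord1 j) mxE.
pose q := \prod_(i <- s) p i.
have q_neq0 : q != 0 by rewrite prodf_seq_neq0; apply/allP => i /p_neq0.
(* These points are distinct in characteristic zero, and there is one more of them than the degree
   of [q]. *)
pose ts := [seq k%:R : F | k <- iota 0 (size q)].
have ts_uniq : uniq ts.
  by rewrite map_inj_uniq ?iota_uniq// => i j /eqP; rewrite eqr_nat => /eqP.
have /allPn[t _ qt] : ~~ all (root q) ts.
  apply/negP => h; have := max_poly_roots q_neq0 h ts_uniq.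
  by rewrite size_map size_iota ltnn.
exists (\row_(j < N) t ^+ j) => i si; rewrite pE.
apply: contra qt => pit; rewrite /root /q horner_prod prodf_seq_eq0.
by apply/hasP; exists i.
Qed.

(** A nonzero column of [cokermx (U i)] is the equation of a hyperplane containing [U i], so it
    suffices to avoid hyperplanes. *)
Lemma avoid_subspaces N (I : eqType) (s : seq I) (U : I -> 'M[F]_N) :
  (forall i, i \in s -> (\rank (U i) < N)%N) ->
  exists v : 'rV[F]_N, forall i, i \in s -> ~~ (v <= U i)%MS.
Proof.
move=> rkU.
have coU i : i \in s -> {j | col j (cokermx (U i)) != 0}.
  move=> /rkU ltU; apply: sigW; apply/existsP.
  apply: contraTT ltU => /existsPn h.
  rewrite -leqNgt -subn_eq0 -mxrank_coker mxrank_eq0; apply/eqP/matrixP => k j.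
  by have /negbNE/eqP/matrixP/(_ k 0) := h j; rewrite !mxE.
pose c i := if pselect (i \in s) is left h
            then col (projT1 (coU i h)) (cokermx (U i)) else 0.
have [|v vP] := @avoid_hyperplanes N I s c.
  by move=> i si; rewrite /c; case: pselect => // h; case: (coU _ _).
exists v => i si; apply: contra (vP i si); rewrite submxE => /eqP vU.
by rewrite /c; case: pselect => // h; rewrite colE mulmxA vU mul0mx mxE.
Qed.

Definition entries N (x : 'rV[F]_N) : seq F := undup [seq x 0 j | j : 'I_N].

Lemma size_entries_le N (x : 'rV[F]_N) : (size (entries x) <= N)%N.
Proof. by rewrite (leq_trans (size_undup _))// size_image card_ord. Qed.

Lemma mem_entries N (x : 'rV[F]_N) y :
  reflect (exists j, y = x 0 j) (y \in entries x).
Proof.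
by rewrite mem_undup; apply: (iffP mapP) => [[j _]|[j]] ->;
  exists j; rewrite ?mem_enum.
Qed.

Lemma size_entries0 N : (size (entries (0 : 'rV[F]_N)) <= 1)%N.
Proof.
apply: (@uniq_leq_size _ _ [:: 0]); first exact: undup_uniq.
by move=> _ /mem_entries[j ->]; rewrite mxE mem_head.
Qed.

Definition fibre_mx N r (f : {ffun 'I_N -> 'I_r}) : 'M[F]_(r, N) :=
  \matrix_(i, j) (f j == i)%:R.

(** Let [f j] be the place of [x 0 j] among the distinct entries; these entries are then the
    coefficients. The bound on their number keeps [inord] off its default value. *)
Lemma entries_fibre_mx N r (x : 'rV[F]_N) : (size (entries x) <= r.+1)%N ->
  exists f : {ffun 'I_N -> 'I_r.+1}, (x <= fibre_mx f)%MS.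
Proof.
move=> le_r; pose f := [ffun j => inord (index (x 0 j) (entries x)) : 'I_r.+1].
exists f; apply/submxP; exists (\row_i (entries x)`_i).
apply/matrixP => i j.
rewrite (ord1 i) {i} mxE (bigD1 (f j))//= big1 => [|i neq].
  have xj : x 0 j \in entries x by apply/mem_entries; exists j.
  rewrite !mxE eqxx mulr1 addr0 ffunE inordK ?nth_index//.
  by rewrite (leq_trans _ le_r)// index_mem.
by rewrite !mxE eq_sym (negbTE neq) mulr0.
Qed.

(* [fibre_mx f] spans the vectors that are constant on the fibres of [f]. The
   rows of [W] are added one at a time, outside finitely many proper subspaces. *)
Lemma exists_transversal_mx N r k : (k + r <= N)%N ->
  exists W : 'M[F]_(k, N), forall (f : {ffun 'I_N -> 'I_r}) (a : 'rV_k),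
    (a *m W <= fibre_mx f)%MS -> a = 0.
Proof.
elim: k => [|k IHk] le_N; first by exists 0 => f a _; rewrite thinmx0.
have [W WP] := IHk (ltnW le_N).
have [|v vP] := @avoid_subspaces N _ (enum {ffun 'I_N -> 'I_r})
    (fun f => (W + fibre_mx f)%MS).
  move=> f _; apply: leq_ltn_trans le_N.
  apply: leq_trans (mxrank_adds_leqif _ _).1 _.
  by apply: leq_add; exact: rank_leq_row.
exists (col_mx v W : 'M[F]_(1 + k, N)) => f a.
pose b : 'M[F]_1 := @lsubmx F 1 1 k a; pose a' := @rsubmx F 1 1 k a.
have aE : a = row_mx b a' by rewrite hsubmxK.
have -> : a *m (col_mx v W : 'M[F]_(1 + k, N)) = b *m v + a' *m W.
  by rewrite aE; exact: (@mul_row_col F 1 1 k N b a' v W).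
move=> sub_f.
(* Were [b] nonzero, dividing by it would put [v] in [W + fibre_mx f], against the choice of [v]. *)
have b0 : b = 0.
  apply/eqP; apply: contraTT (vP f (mem_enum _ _)) => b_neq0; apply/negPn.
  have bU : b \in unitmx.
    rewrite unitmxE det_mx11 unitfE; apply: contra_neq b_neq0 => b00.
    by apply/matrixP => i j; rewrite !ord1 b00 mxE.
  rewrite -(eqmxMfull _ (_ : row_full b)) ?row_full_unit//.
  rewrite -[b *m v](addrK (a' *m W)) addmx_sub//.
    exact: submx_trans sub_f (addsmxSr _ _).
  by rewrite eqmx_opp (submx_trans _ (addsmxSl _ _))// submxMl.
rewrite aE b0 (_ : a' = 0) ?row_mx0//; apply: (WP f).
by move: sub_f; rewrite b0 mul0mx add0r.
Qed.

Lemma exists_many_entries_mx N r k : (k + r.+1 <= N)%N ->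
  exists W : 'M[F]_(k, N), forall a : 'rV_k,
    a != 0 -> (r.+1 < size (entries (a *m W)))%N.
Proof.
move=> /exists_transversal_mx[W WP]; exists W => a; apply: contraNltn.
by move=> /entries_fibre_mx[f /WP ->].
Qed.

(* A functional annihilating [k] differences with a fixed column of [W]
   identifies [k.+1] columns. *)
Lemma exists_few_entries N k (W : 'M[F]_(k.+1, N)) :
  exists2 a : 'rV_k.+1, a != 0 & (size (entries (a *m W)) <= (N - k.+1).+1)%N.
Proof.
case: N W => [|N] W.
  exists (const_mx 1); last exact: leq_trans (size_entries_le _) _.
  by apply/eqP => /matrixP/(_ 0 0); rewrite !mxE => /eqP; rewrite oner_eq0.
(* If [j.+1] exceeds [N], [inord] returns [0] and the column is zero, which is harmless. As [D] has
   more rows than columns, its left kernel is nonzero. *)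
pose D : 'M[F]_(k.+1, k) := \matrix_(i, j) (W i (inord j.+1) - W i 0).
have /rowV0Pn[a /sub_kermxP aD a_neq0] : kermx D != 0.
  by rewrite -mxrank_eq0 mxrank_ker subn_eq0 -ltnNge ltnS rank_leq_col.
exists a => //; set x := a *m W.
have x0 (j : 'I_N.+1) : (j <= k)%N -> x 0 j = x 0 0.
  case: (posnP j) => [j0 _|j_gt0 jk]; first by congr (x _ _); exact/val_inj.
  have jk' : (j.-1 < k)%N by rewrite prednK.
  apply/eqP; rewrite -subr_eq0; apply/eqP.
  transitivity ((a *m D) 0 (Ordinal jk')); last by rewrite aD mxE.
  rewrite !mxE -sumrB; apply: eq_bigr => i _; rewrite !mxE mulrBr /=.
  by rewrite prednK// inord_val.
(* Positions [0] to [k] share one value; if [k >= N], the subtraction truncates and only that value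
   is listed. *)
pose s := x 0 0 :: [seq x 0 (inord j) | j <- iota k.+1 (N.+1 - k.+1)].
have -> : (N.+1 - k.+1).+1 = size s by rewrite /= size_map size_iota.
apply: uniq_leq_size; first exact: undup_uniq.
move=> _ /mem_entries[j ->].
have [/x0->|kj] := leqP j k; first exact: mem_head.
rewrite inE; apply/orP; right; apply/mapP.
exists (val j); last by rewrite inord_val.
by rewrite mem_iota kj subnKC ?ltn_ord// (leq_trans kj)// ltnW.
Qed.

(** For distinct columns [i] and [j], equality of the corresponding entries of [a *m W] confines [a]
    to a hyperplane; a generic [a] avoids them all. *)
Lemma exists_injective_entries N k (W : 'M[F]_(k, N)) :
  injective (fun j => col j W) ->
  exists a : 'rV_k, size (entries (a *m W)) = N.
Proof.
move=> injW; pose s := [seq p <- enum {: 'I_N * 'I_N} | p.1 != p.2].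
have [[i j]|a aP] := @avoid_hyperplanes k _ s (fun p => col p.1 W - col p.2 W).
  by rewrite mem_filter /= subr_eq0 (inj_eq injW) => /andP[].
exists a; rewrite /entries undup_id ?size_image ?card_ord//.
rewrite map_inj_uniq ?enum_uniq// => i j aij; apply/eqP/negPn/negP => ij.
have /aP/eqP : (i, j) \in s by rewrite mem_filter ij mem_enum.
apply; rewrite /= mulmxBr !colE !mulmxA -!colE.
by move: aij; rewrite !mxE => ->; rewrite subrr.
Qed.
End LinearAlgebra.

(** * Finite bases as indexed families *)

Section Dimension.
Variables (R : realType) (V : lmodType R).
Implicit Types W : set V.

Definition free_family k (v : 'I_k -> V) :=
  forall a : 'rV[R]_k, \sum_i a 0 i *: v i = 0 -> a = 0.

Lemma free_family_inj k (v : 'I_k -> V) : free_family v -> injective v.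
Proof.
move=> fv i j vij; apply/eqP; apply: contraT => neq_ij.
have /fv : \sum_l (delta_mx 0 i - delta_mx 0 j : 'rV[R]_k) 0 l *: v l = 0.
  rewrite (bigD1 i)//= (bigD1 j) 1?eq_sym//= big1 => [|l /andP[li lj]].
    rewrite !mxE !eqxx (negbTE neq_ij) eq_sym (negbTE neq_ij) /= subr0 sub0r.
    by rewrite scale1r scaleN1r addr0 vij subrr.
  by rewrite !mxE (negbTE li) (negbTE lj) subrr scale0r.
move=> /rowP/(_ i); rewrite !mxE !eqxx (negbTE neq_ij) subr0 => /eqP.
by rewrite oner_eq0.
Qed.

Lemma sum_family k (v : 'I_k -> V) (s : seq V) (c : V -> R) :
  injective v -> [set` s] `<=` range v ->
  \sum_(u <- s) c u *: u = \sum_i (\sum_(u <- s | v i == u) c u) *: v i.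
Proof.
move=> injv sv; under [RHS]eq_bigr do rewrite scaler_suml.
rewrite (exchange_big_dep predT)//= big_seq [RHS]big_seq.
apply: eq_bigr => u /sv[i _ <-].
by rewrite (big_pred1 i)// => j /=; rewrite (inj_eq injv).
Qed.

Lemma lin_span_range k (v : 'I_k -> V) : injective v ->
  lin_span (range v) = range (fun a : 'rV[R]_k => \sum_i a 0 i *: v i).
Proof.
move=> injv; apply/seteqP; split=> [_ [s [c [sv ->]]]|_ [a _ <-]].
  exists (\row_i \sum_(u <- s | v i == u) c u) => //.
  by rewrite (sum_family _ injv sv); apply: eq_bigr => i _; rewrite mxE.
exists [seq v i | i : 'I_k], (fun u => \sum_(i | v i == u) a 0 i).
split=> [u /= /mapP[i _ ->]|]; first by exists i.
rewrite big_image /=; apply: eq_bigr => i _; congr (_ *: _).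
by rewrite (big_pred1 i)// => j /=; rewrite (inj_eq injv).
Qed.

Lemma lin_indep_range k (v : 'I_k -> V) : injective v ->
  lin_indep (range v) <-> free_family v.
Proof.
move=> injv; split=> [indep a a0|fv s c us sv /=].
  apply/rowP => i; pose c u := \sum_(j | v j == u) a 0 j.
  have cv j : c (v j) = a 0 j.
    by rewrite /c (big_pred1 j)// => l /=; rewrite (inj_eq injv).
  rewrite -cv mxE; apply: (indep [seq v j | j : 'I_k]).
  - by rewrite map_inj_uniq ?enum_uniq.
  - by move=> u /= /mapP[j _ ->]; exists j.
  - by rewrite big_image /= -[RHS]a0; apply: eq_bigr => j _; rewrite cv.
  - by rewrite map_f// mem_enum.
rewrite (sum_family _ injv sv) => s0 u us'.
have [i _ viu] := sv _ us'.
have /fv/rowP/(_ i) :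
    \sum_i (\row_i \sum_(u <- s | v i == u) c u) 0 i *: v i = 0.
  by rewrite -[RHS]s0; apply: eq_bigr => j _; rewrite mxE.
rewrite !mxE viu (eq_bigl (pred1 u)) => [|w]; last by rewrite eq_sym.
by rewrite big_mkcond /= -big_mkcond -big_filter filter_pred1_uniq// big_seq1.
Qed.

(** Indexing the basis by ['I_k] turns vectors of the subspace into rows of coefficients, to which
    matrix algebra applies. *)
Lemma has_dimension_family W k :
  has_dimension W `I_k <->
  exists2 v : 'I_k -> V, free_family v &
    W = range (fun a : 'rV[R]_k => \sum_i a 0 i *: v i).
Proof.
split=> [[B [indepB <- /card_set_bijP[f [fB finj fsurj]]]]|[v fv ->]].
  have /choice[v vP] (i : 'I_k) : exists u, B u /\ f u = i.
    by have [|u Bu fu] := fsurj i; [exact: ltn_ord|exists u].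
  have injv : injective v.
    move=> i j vij; apply/val_inj.
    by have [_ /= <-] := vP i; have [_ /= <-] := vP j; rewrite vij.
  have BE : B = range v.
    apply/seteqP; split=> [u Bu|_ [i _ <-]]; last by have [] := vP i.
    exists (Ordinal (fB _ Bu)) => //; have [Bv fv] := vP (Ordinal (fB _ Bu)).
    by apply: finj; rewrite ?inE.
  exists v; first by apply/(lin_indep_range injv); rewrite -BE.
  by rewrite BE lin_span_range.
have injv := free_family_inj fv.
exists (range v); split; first exact/lin_indep_range.
  exact: lin_span_range.
apply: (card_eq_trans (inj_card_eq (in2W injv))).
apply: card_eq_trans (card_esym (inj_card_eq (in2W val_inj))) _.
have -> // : val @` [set: 'I_k] = `I_k.
apply/seteqP; split=> [_ [i _ <-]|i ik]; first exact: ltn_ord.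
by exists (Ordinal ik).
Qed.

End Dimension.

(** * Accumulation points as limits along free ultrafilters *)

Section Accumulation.
Variable R : realType.

Definition free_ultra (U : set_system nat) :=
  UltraFilter U /\ forall A, cofinite_set A -> U A.

(** Every bounded sequence converges along a given ultrafilter, so this form lets several sequences
    pass to the limit together. *)
Lemma acc_ptP (x : linfty R) (eta : R) :
  acc_pt x eta <-> exists2 U, free_ultra U & x n @[n --> U] --> eta.
Proof.
split=> [acc|[U [UU coU]] xU eps eps_gt0 fin]; last first.
  move/cvgrPdist_lt : xU => /(_ _ eps_gt0); rewrite /= => near_eta.
  have : U (~` [set n | `|x n - eta| < eps]).
    by apply: coU; rewrite setCK.
  move=> /(filterI near_eta) UI; have [n [/=]] := filter_ex UI.
  by rewrite distrC => ->.
(* Accumulation at [eta] makes this filter proper; discarding finite sets [B] makes every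
   ultrafilter above it free. *)
pose F : set_system nat := fun A => exists2 eps : R, 0 < eps &
  exists2 B, finite_set B & [set n | `|x n - eta| < eps] `\` B `<=` A.
have FF : ProperFilter F.
  split=> [[e e0 [B finB sub0]]|].
    by have [m /sub0] := infinite_setN0 (infinite_setD (acc _ e0) finB).
  split=> [|A C [e e0 [B finB subA]] [e' e'0 [B' finB' subC]]|
           A C AC [e e0 [B finB subA]]].
  - by exists 1 => //; exists set0.
  - exists (Num.min e e'); first by rewrite lt_min e0.
    exists (B `|` B'); first by rewrite finite_setU.
    move=> m /= [+ /not_orP[Bm B'm]]; rewrite lt_min => /andP[me me'].
    by split; [exact: subA|exact: subC].
  - by exists e => //; exists B => // m /subA/AC.
have [U [UU FU]] := ultraFilterLemma FF.
exists U; first split=> // A finCA.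
  by apply: FU; exists 1 => //; exists (~` A) => // m [_ /contrapT].
apply/cvgrPdist_lt => e e0; apply: FU; exists e => //; exists set0 => // m [/=].
by rewrite distrC.
Qed.

Lemma free_ultra_cvg (x : linfty R) U : free_ultra U ->
  exists p : R, x n @[n --> U] --> p.
Proof.
move=> [UU _]; have := linfty_seqP x; rewrite inE => -[M xM].
have /(_ (x @ U) _)[|p [_ clp]] := @segment_compact R (- M) M.
  apply: (@filterS _ U _ setT) => [n _ /=|].
    by rewrite in_itv /= -ler_norml.
  exact: filterT.
(* A cluster point of an ultrafilter is a limit: the complement of a neighbourhood cannot have its
   preimage in [U]. *)
exists p => B nbhsB /=.
have [//|UnB] := in_ultra_setVsetC (x @^-1` B) UU.
by have [y [/= ]] := clp (~` B) B UnB nbhsB.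
Qed.

(** One ultrafilter serves all coordinates, so this set may be smaller than the product of the sets
    [acc_set (v i)]. *)
Definition ultra_limits k (v : 'I_k -> linfty R) : set 'rV[R]_k :=
  [set p | exists2 U, free_ultra U & forall i, v i n @[n --> U] --> p 0 i].

Lemma linfty_sumE k (v : 'I_k -> linfty R) (a : 'rV[R]_k) n :
  (\sum_i a 0 i *: v i) n = \sum_i a 0 i * v i n.
Proof.
exact: (big_morph (fun y : linfty R => y n)).
Qed.

(** Limits are linear. Conversely, along an ultrafilter where the sum tends to [eta], each [v i]
    converges too, and uniqueness of limits identifies [eta]. *)
Lemma acc_set_sum k (v : 'I_k -> linfty R) (a : 'rV[R]_k) :
  acc_set (\sum_i a 0 i *: v i) =
  [set (a *m p^T) 0 0 | p in ultra_limits v].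
Proof.
have cvg_a U (p : 'rV_k) : free_ultra U ->
    (forall i, v i n @[n --> U] --> p 0 i) ->
    (\sum_i a 0 i *: v i) n @[n --> U] --> (a *m p^T) 0 0.
  move=> [UU _] vp; under eq_cvg do rewrite linfty_sumE.
  rewrite mxE; under eq_bigr do rewrite mxE.
  apply: cvg_big => [|i _]; first exact: add_continuous.
  by apply: cvgM => //; exact: cvg_cst.
apply/seteqP; split=> [eta /acc_ptP[U freeU cvg_eta]|_ [p [U freeU vp] <-]];
  last first.
  by apply/acc_ptP; exists U => //; exact: cvg_a.
have /choice[p pP] i := free_ultra_cvg (v i) freeU.
have UP : ProperFilter U by case: freeU => UU _; exact: ultra_proper.
have vp i : v i n @[n --> U] --> (\row_j p j) 0 i by rewrite mxE; exact: pP.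
exists (\row_j p j); first by exists U.
exact: norm_cvg_unique (cvg_a _ _ freeU vp) cvg_eta.
Qed.

(** Each coordinate of a joint limit is an accumulation point of the matching [v i], which leaves
    finitely many rows. *)
Lemma finite_ultra_limits k (v : 'I_k -> linfty R) :
  (forall i, finite_set (acc_set (v i))) -> finite_set (ultra_limits v).
Proof.
move=> fin_acc.
have /choice[s sP] i : exists s : seq R, acc_set (v i) = [set` s].
  exact/finite_seqP.
pose t := flatten [seq s i | i : 'I_k].
apply: (@sub_finite_set _ _
  (range (fun f : {ffun 'I_k -> seq_sub t} => \row_i val (f i)))).
  move=> p [U freeU vp].
  have pt i : p 0 i \in t.
    apply/flatten_mapP; exists i; first exact: mem_enum.
    have : acc_set (v i) (p 0 i) by apply/acc_ptP; exists U.
    by rewrite sP.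
  exists [ffun i => SeqSub (pt i)] => //.
  by apply/rowP => i; rewrite mxE ffunE.
exact/finite_image/finite_finset.
Qed.

Lemma Lcard_seq (x : linfty R) (s : seq R) m :
  acc_set x = [set` s] -> Lcard `I_m x <-> size (undup s) = m.
Proof.
move=> accE; rewrite /Lcard /= accE -(size_seq_fset tt).
have -> : [set` s] = [set` seq_fset tt s].
  by apply/seteqP; split=> y; rewrite /mkset seq_fsetE.
by split=> [/card_eq_fsetP|h]; last apply/card_eq_fsetP.
Qed.

End Accumulation.

(** * Accumulation points as entries of a vector *)

Section JointAccumulation.
Variable R : realType.

(** The columns of [W] list the joint limits of [v], each once. *)
Lemma acc_set_entries k (v : 'I_k -> linfty R) :
  (forall i, finite_set (acc_set (v i))) ->
  exists N (W : 'M[R]_(k, N)), injective (fun j => col j W) /\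
    forall a : 'rV_k, acc_set (\sum_i a 0 i *: v i) = [set` entries (a *m W)].
Proof.
move=> /finite_ultra_limits/finite_seqP[s limE]; pose t := undup s.
exists (size t), (\matrix_(i, j) t`_j 0 i); split=> [i j colij|a].
  apply/val_inj/eqP.
  rewrite -(nth_uniq 0 (ltn_ord i) (ltn_ord j) (undup_uniq s)).
  by apply/eqP/rowP => l; move/colP/(_ l): colij; rewrite !mxE.
set W := \matrix_(i, j) _.
have aW j : (a *m W) 0 j = (a *m (t`_j)^T) 0 0.
  by rewrite !mxE; apply: eq_bigr => i _; rewrite !mxE.
rewrite acc_set_sum limE; apply/seteqP.
split=> [_ [p /= ps <-]|_ /mem_entries[j ->]]; last first.
  by rewrite aW; exists t`_j => //=; rewrite -mem_undup mem_nth.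
have pt : p \in t by rewrite mem_undup.
have it : (index p t < size t)%N by rewrite index_mem.
by apply/mem_entries; exists (Ordinal it); rewrite aW /= nth_index.
Qed.

Lemma acc_set_periodic N (y : 'rV[R]_N.+1) (x : linfty R) :
  (forall m, x m = y 0 (inord (m %% N.+1))) -> acc_set x = [set` entries y].
Proof.
move=> xy; apply/seteqP; split=> [eta acc|_ /mem_entries[j ->] eps eps_gt0].
  (* A finite set is closed, so some ball around [eta] misses every value of [x]. *)
  apply/negPn/negP => yNeta.
  have /closed_openC clS : closed [set` entries y].
    apply: accessible_finite_set_closed.1; last exact: finite_seq.
    exact/hausdorff_accessible/Rhausdorff.
  have /nbhs_ballP[e /= e0 sub] : nbhs eta (~` [set` entries y]).
    by apply: open_nbhs_nbhs; split=> //; exact/negP.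
  have [m /= xm] := infinite_setN0 (acc _ e0).
  apply: (sub (x m)); first by rewrite /ball /= distrC.
  by apply/mem_entries; exists (inord (m %% N.+1)).
(* [f] runs through the residue class of [j], on which [x] is constantly [y 0 j]. *)
pose f m := (m * N.+1 + j)%N.
have finj : injective f.
  by move=> p q /addIn/eqP; rewrite eqn_pmul2r// => /eqP.
move/(finite_preimage (in2W finj)) => fin; apply: infinite_nat.
apply: sub_finite_set fin => m _ /=.
by rewrite /f xy modnMDl modn_small// inord_val subrr normr0.
Qed.

End JointAccumulation.

(** * The two bounds on lineability *)

Section Lineability.
Variable R : realType.

Definition Lbetween (n d : nat) : set (linfty R) :=
  \bigcup_(m in [set m : nat | (n <= m <= n + d)%N]) Lcard `I_m.

Lemma Lbetween_seq n d (x : linfty R) (s : seq R) : uniq s ->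
  acc_set x = [set` s] -> Lbetween n d x <-> (n <= size s <= n + d)%N.
Proof.
move=> us xs; split=> [[m /= nm]|nm].
  by rewrite (Lcard_seq _ xs) undup_id// => ->.
by exists (size s) => //; rewrite (Lcard_seq _ xs) undup_id.
Qed.

Lemma lineable_Lbetween n d : (2 <= n)%N -> lineable `I_(d + 1) (Lbetween n d).
Proof.
(* Here [n] is [r.+2] and the period [N.+1] is [n + d], which equals [(d + 1) + r.+1]. *)
case: n => [|[|r]]// _; pose N := (r + d).+1.
have [|W WP] := @exists_many_entries_mx R N.+1 r (d + 1).
  by rewrite /N; lia.
pose x i (m : nat) : R := W i (inord (m %% N.+1)).
have bx i : x i \in @bounded_seq R.
  rewrite inE; exists (\sum_j `|W i j|) => m.
  by rewrite (bigD1 (inord (m %% N.+1)))//= lerDl sumr_ge0.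
pose v i := Linfty (bx i).
have vE (a : 'rV_(d + 1)) m :
    (\sum_i a 0 i *: v i) m = (a *m W) 0 (inord (m %% N.+1)).
  by rewrite linfty_sumE mxE.
exists (range (fun a : 'rV[R]_(d + 1) => \sum_i a 0 i *: v i)); split.
- split=> [|c _ _ /set_mem[a _ <-] /set_mem[b _ <-]]; apply/mem_set.
    by exists 0 => //; apply: big1 => i _; rewrite mxE scale0r.
  exists (c *: a + b) => //; rewrite scaler_sumr -big_split /=.
  by apply: eq_bigr => i _; rewrite !mxE scalerDl scalerA.
(* A nonzero [a] gives at least two entries, whereas a zero sequence forces [a *m W = 0], which has
   at most one. *)
- apply/has_dimension_family; exists v => // a a0; apply: contra_eq a0 => /WP.
  apply: contraTneq => a0; rewrite -leqNgt.
  suff -> : a *m W = 0 by rewrite (leq_trans (size_entries0 _ _)).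
  apply/rowP => j; have := vE a j.
  rewrite a0 modn_small ?ltn_ord// inord_val => <-.
  by rewrite mxE.
- move=> _ [a _ <-]; have [->|/WP aW] := eqVneq a 0.
    by right; apply: big1 => i _; rewrite mxE scale0r.
  left; apply/(Lbetween_seq _ _ (undup_uniq _) (acc_set_periodic (vE a))).
  by rewrite aW (leq_trans (size_entries_le _)).
Qed.

Lemma not_lineable_Lbetween n d : (2 <= n)%N ->
  ~ lineable `I_d.+2 (Lbetween n d).
Proof.
move=> n2 [W [_ /has_dimension_family[v fv ->] subM]].
have Lv (a : 'rV_d.+2) : a != 0 -> Lbetween n d (\sum_i a 0 i *: v i).
  move=> a0; have [|//|/= x0] := subM (\sum_i a 0 i *: v i); first by exists a.
  by move/fv : x0 a0 => ->; rewrite eqxx.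
have finv i : finite_set (acc_set (v i)).
  have -> : v i = \sum_j (delta_mx 0 i : 'rV[R]_d.+2) 0 j *: v j.
    rewrite (bigD1 i)//= big1 => [|j ji].
      by rewrite mxE !eqxx scale1r addr0.
    by rewrite mxE (negbTE ji) andbF scale0r.
  have [|m _ accm] := Lv (delta_mx 0 i); last by exists m.
  by apply/eqP => /rowP/(_ i)/eqP; rewrite !mxE !eqxx oner_eq0.
have [N [P [injP accE]]] := acc_set_entries finv.
have sizeP a : a != 0 -> (n <= size (entries (a *m P)) <= n + d)%N.
  by move/Lv; rewrite (Lbetween_seq _ _ (undup_uniq _) (accE a)).
have leN : (N <= n + d)%N.
  have [a <-] := exists_injective_entries injP.
  have [->|/sizeP/andP[]//] := eqVneq a 0.
  rewrite mul0mx (leq_trans (size_entries0 _ _))//.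
  by rewrite (leq_trans _ (leq_addr _ _))// ltnW.
(* This [a] yields at most [(N - d.+2).+1] entries, which is below [n] by [leN], or by [n2] if the
   subtraction truncates. *)
have [a /sizeP/andP[le_n _] le_few] := exists_few_entries P.
by have := leq_trans le_n le_few; lia.
Qed.

End Lineability.

Theorem theorem4p4 (R : realType) (n d : nat) (hn : (2 <= n)%N) :
  let M : set (linfty R) :=
    \bigcup_(m in [set m : nat | (n <= m <= n + d)%N]) Lcard `I_m in
  lineable `I_(d + 1) M /\ ~ lineable `I_(d + 2) M.
Proof.
rewrite addn2.
by split; [exact: lineable_Lbetween|exact: not_lineable_Lbetween].
Qed.
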